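(* $$\sum_{i=1}^{\infty } \frac{3^i \sum_{j=1}^i \frac{1}{j^2}}{(1+2 i) \binom{2 i}{i}}= \frac{8 \pi ^3}{81 \sqrt{3}}.$$
   Context: $\binom{2i}{i}$ is the central binomial coefficient; the outer sum is a convergent series of real numbers. *)

(* Defs.v *)
From Stdlib Require Import Reals.
From Coquelicot Require Import Coquelicot.
Open Scope R_scope.

(* [Binomial.C] is qualified because Coquelicot's [C] is the type of complex
   numbers. *)
Definition term (i : nat) : R :=
  3 ^ i * sum_n_m (fun j : nat => 1 / INR j ^ 2) 1 i
  / ((1 + 2 * INR i) * Binomial.C (2 * i) i).

(* Main.v *)
Require Import Defs.
From Stdlib Require Import Reals.
From Coquelicot Require Import Coquelicot.
From Stdlib Require Import Lra Lia.
Open Scope R_scope.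

(** Substituting [y = sin t] in a classical arcsine expansion, the series is
    the point [t = PI / 3] of
      [sum_i 4^i H_i / ((2 i + 1) C(2 i, i)) * sin t ^ (2 i + 1)
         = 2 / 3 * t ^ 3 / cos t],
    where [H_i = sum_(1 <= j <= i) 1 / j ^ 2].  (It is the
    opposite of the coefficient of [b ^ 2] in
      [sin (2 b t) / (2 b cos t)
         = sum_i u_i * prod_(1 <= j <= i) (1 - b ^ 2 / j ^ 2)
                 * sin t ^ (2 i + 1)],
    with [u_i] as follows.)

    Write [u_i = 4^i / ((2 i + 1) C(2 i, i))], so that
    [(2 i + 3) u_(i+1) = (2 i + 2) u_i].  This recurrence makes the derivatives
    of the following three partial sums telescope
    ([is_derive_arc], [is_derive_arc_sq], [is_derive_arc_cube]):
      - [cos t * sum_i u_i sin t ^ (2 i + 1)] has derivative [1], hence tends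
        to [t];
      - [sum_i u_i / (i + 1) * sin t ^ (2 i + 2)] has for derivative twice the
        previous sum, hence tends to [t ^ 2];
      - [cos t * sum_i u_i H_i sin t ^ (2 i + 1)] has for derivative twice the
        previous sum, hence tends to [2 / 3 * t ^ 3];
    the first and third of these hold up to a boundary term of order at most
    [n ^ 2 * sin t ^ (2 n)].  The mean value theorem turns the small error on
    each derivative into a small error on the function, uniformly on
    [[0, x]] with [x < PI / 2] ([arc_error], [arc_sq_error],
    [arc_cube_error]). *)

(** * Coefficients *)

Definition arc_coef (i : nat) : R :=
  4 ^ i / ((1 + 2 * INR i) * Binomial.C (2 * i) i).

Definition harmonic2 (i : nat) : R :=
  sum_n_m (fun j : nat => 1 / INR j ^ 2) 1 i.

Lemma central_binomial_pos (i : nat) : 0 < Binomial.C (2 * i) i.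
Proof.
  unfold Binomial.C. apply Rdiv_lt_0_compat.
  - apply INR_fact_lt_0.
  - apply Rmult_lt_0_compat; apply INR_fact_lt_0.
Qed.

Lemma central_binomial_S (i : nat) :
  (INR i + 1) * Binomial.C (2 * S i) (S i)
  = 2 * (2 * INR i + 1) * Binomial.C (2 * i) i.
Proof.
  unfold Binomial.C.
  replace (2 * S i - S i)%nat with (S i) by lia.
  replace (2 * i - i)%nat with i by lia.
  replace (2 * S i)%nat with (S (S (2 * i))) by lia.
  rewrite !fact_simpl, !mult_INR, !S_INR, mult_INR.
  change (INR 2) with 2.
  pose proof (INR_fact_neq_0 i). pose proof (pos_INR i).
  field. split; lra.
Qed.

Lemma arc_coef_0 : arc_coef 0 = 1.
Proof. unfold arc_coef, Binomial.C. simpl. field. Qed.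

Lemma arc_coef_S (i : nat) :
  arc_coef (S i) = arc_coef i * (2 * INR i + 2) / (2 * INR i + 3).
Proof.
  unfold arc_coef.
  pose proof (central_binomial_pos i) as Hp.
  pose proof (central_binomial_S i) as HS.
  pose proof (pos_INR i).
  replace (Binomial.C (2 * S i) (S i))
    with (2 * (2 * INR i + 1) * Binomial.C (2 * i) i / (INR i + 1))
    by (rewrite <- HS; field; lra).
  rewrite S_INR. simpl pow. field. repeat split; lra.
Qed.

Lemma arc_coef_bounds (i : nat) : 0 <= arc_coef i <= 1.
Proof.
  induction i as [|i IH].
  - rewrite arc_coef_0. lra.
  - rewrite arc_coef_S. pose proof (pos_INR i).
    unfold Rdiv. rewrite Rmult_assoc.
    assert (0 <= (2 * INR i + 2) * / (2 * INR i + 3) <= 1).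
    { split.
      - apply Rdiv_le_0_compat; lra.
      - apply Rle_div_l; lra. }
    nra.
Qed.

Lemma harmonic2_S (i : nat) :
  harmonic2 (S i) = harmonic2 i + 1 / (INR i + 1) ^ 2.
Proof.
  unfold harmonic2. rewrite sum_n_Sm by lia. rewrite S_INR. reflexivity.
Qed.

Lemma harmonic2_bounds (i : nat) : 0 <= harmonic2 i <= INR i.
Proof.
  induction i as [|i IH].
  - unfold harmonic2. rewrite sum_n_m_zero by lia. simpl. change zero with 0. lra.
  - rewrite harmonic2_S, S_INR. pose proof (pos_INR i).
    assert (0 <= 1 / (INR i + 1) ^ 2 <= 1).
    { split.
      - apply Rdiv_le_0_compat; nra.
      - apply Rle_div_l; nra. }
    lra.
Qed.

(** * Partial sums and their derivatives *)

Definition arc (n : nat) (t : R) : R :=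
  cos t * sum_n (fun i => arc_coef i * sin t ^ (2 * i + 1)) n.

Definition arc_sq (n : nat) (t : R) : R :=
  sum_n (fun i => arc_coef i / (INR i + 1) * sin t ^ (2 * i + 2)) n.

(** The index is shifted because the term with [harmonic2 0 = 0] vanishes. *)
Definition arc_cube (n : nat) (t : R) : R :=
  cos t * sum_n (fun i => arc_coef (S i) * harmonic2 (S i)
                          * sin t ^ (2 * i + 3)) n.

(** Stated with the addition of [R] rather than that of the canonical structure,
    so that [ring] and [field] apply after rewriting. *)
Lemma sum_n_S_real (a : nat -> R) (n : nat) :
  sum_n a (S n) = sum_n a n + a (S n).
Proof. exact (sum_Sn a n). Qed.

Lemma sum_n_eq_0 (a : nat -> R) (n : nat) :
  (forall i, a i = 0) -> sum_n a n = 0 :> R.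
Proof.
  intros Ha. induction n as [|n IH].
  - rewrite sum_O. apply Ha.
  - rewrite sum_n_S_real, IH, Ha. apply Rplus_0_l.
Qed.

Lemma arc_S (n : nat) (t : R) :
  arc (S n) t
  = arc n t + arc_coef (S n) * (cos t * sin t ^ S (2 * n + 2)).
Proof.
  unfold arc. rewrite sum_n_S_real.
  replace (2 * S n + 1)%nat with (S (2 * n + 2)) by lia. ring.
Qed.

Lemma arc_sq_S (n : nat) (t : R) :
  arc_sq (S n) t
  = arc_sq n t + arc_coef (S n) / (INR (S n) + 1) * sin t ^ S (2 * n + 3).
Proof.
  unfold arc_sq. rewrite sum_n_S_real.
  replace (2 * S n + 2)%nat with (S (2 * n + 3)) by lia. reflexivity.
Qed.

Lemma arc_cube_S (n : nat) (t : R) :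
  arc_cube (S n) t
  = arc_cube n t
    + arc_coef (S (S n)) * harmonic2 (S (S n)) * (cos t * sin t ^ S (2 * n + 4)).
Proof.
  unfold arc_cube. rewrite sum_n_S_real.
  replace (2 * S n + 3)%nat with (S (2 * n + 4)) by lia. ring.
Qed.

Lemma is_derive_sin_pow (k : nat) (t : R) :
  is_derive (fun t => sin t ^ S k) t ((INR k + 1) * cos t * sin t ^ k).
Proof.
  auto_derive; [easy|]. simpl pred.
  change (match k with 0%nat => 1 | S _ => INR k + 1 end) with (INR (S k)).
  rewrite S_INR. ring.
Qed.

(** [cos ^ 2 = 1 - sin ^ 2] leaves two even powers of [sin], which is what lets
    consecutive terms of the partial sums cancel. *)
Lemma is_derive_cos_sin_pow (k : nat) (t : R) :
  is_derive (fun t => cos t * sin t ^ S k) t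
    ((INR k + 1) * sin t ^ k - (INR k + 2) * sin t ^ (k + 2)).
Proof.
  evar_last.
  - apply (is_derive_mult cos (fun t => sin t ^ S k)).
    + apply is_derive_Reals, derivable_pt_lim_cos.
    + apply is_derive_sin_pow.
    + intros; apply Rmult_comm.
  - unfold plus, mult; simpl.
    pose proof (sin2_cos2 t) as H. unfold Rsqr in H.
    rewrite pow_add. simpl.
    replace (cos t * ((INR k + 1) * cos t * sin t ^ k))
      with ((INR k + 1) * (1 - sin t * sin t) * sin t ^ k)
      by (rewrite <- H; ring).
    ring.
Qed.

Lemma is_derive_add_scale (f g : R -> R) (c t df dg : R) :
  is_derive f t df -> is_derive g t dg ->
  is_derive (fun t => f t + c * g t) t (df + c * dg).
Proof.
  intros Hf Hg.
  apply (is_derive_plus f (fun t => c * g t) t df (c * dg) Hf).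
  apply (is_derive_scal g t c dg Hg).
Qed.

Lemma is_derive_sub (f g : R -> R) (t df dg : R) :
  is_derive f t df -> is_derive g t dg ->
  is_derive (fun t => f t - g t) t (df - dg).
Proof. exact (is_derive_minus f g t df dg). Qed.

Lemma is_derive_arc (n : nat) (t : R) :
  is_derive (arc n) t
    (1 - (2 * INR n + 2) * arc_coef n * sin t ^ (2 * n + 2)).
Proof.
  induction n as [|n IH].
  - apply (is_derive_ext (fun t => cos t * sin t ^ 1)).
    { intros s. unfold arc. rewrite sum_O, arc_coef_0. simpl. ring. }
    evar_last. { apply is_derive_cos_sin_pow. }
    rewrite arc_coef_0. simpl. ring.
  - apply (is_derive_ext _ _ _ _ (fun s => eq_sym (arc_S n s))).
    evar_last.
    { apply is_derive_add_scale; [exact IH|apply is_derive_cos_sin_pow]. }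
    rewrite arc_coef_S. pose proof (pos_INR n).
    replace (2 * S n + 2)%nat with (2 * n + 2 + 2)%nat by lia.
    rewrite S_INR, plus_INR, mult_INR. change (INR 2) with 2.
    field. lra.
Qed.

Lemma is_derive_arc_sq (n : nat) (t : R) :
  is_derive (arc_sq n) t (2 * arc n t).
Proof.
  induction n as [|n IH].
  - apply (is_derive_ext (fun t => sin t ^ 2)).
    { intros s. unfold arc_sq. rewrite sum_O, arc_coef_0. simpl. field. }
    evar_last. { apply is_derive_sin_pow. }
    unfold arc. rewrite sum_O, arc_coef_0. simpl. ring.
  - apply (is_derive_ext _ _ _ _ (fun s => eq_sym (arc_sq_S n s))).
    evar_last.
    { apply is_derive_add_scale; [exact IH|apply is_derive_sin_pow]. }
    unfold arc. rewrite sum_n_S_real.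
    replace (2 * S n + 1)%nat with (2 * n + 3)%nat by lia.
    pose proof (pos_INR n).
    rewrite S_INR, plus_INR, mult_INR. change (INR 2) with 2.
    replace (INR 3) with 3 by (simpl; ring).
    field. lra.
Qed.

(** Since [u_(i+1) H_(i+1) = (2 i + 2) / (2 i + 3) * u_i * (H_i + 1 / (i+1)^2)],
    the part with [H_i] cancels against the previous term, and
    [1 / (i+1)^2] contributes exactly the [i]-th term of [2 * arc_sq]. *)
Lemma is_derive_arc_cube (n : nat) (t : R) :
  is_derive (arc_cube n) t
    (2 * arc_sq n t
     - (2 * INR n + 4) * arc_coef (S n) * harmonic2 (S n)
       * sin t ^ (2 * n + 4)).
Proof.
  induction n as [|n IH].
  - apply (is_derive_ext (fun t => 2 / 3 * (cos t * sin t ^ 3))).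
    { intros s. unfold arc_cube. rewrite sum_O, harmonic2_S, arc_coef_S, arc_coef_0.
      unfold harmonic2. rewrite sum_n_m_zero by lia.
      unfold scal, zero; simpl; unfold mult; simpl. field. }
    evar_last.
    { apply is_derive_scal, is_derive_cos_sin_pow. }
    unfold arc_sq. rewrite sum_O, harmonic2_S, arc_coef_S, arc_coef_0.
    unfold harmonic2. rewrite sum_n_m_zero by lia.
    unfold zero; simpl. field.
  - apply (is_derive_ext _ _ _ _ (fun s => eq_sym (arc_cube_S n s))).
    evar_last.
    { apply is_derive_add_scale; [exact IH|apply is_derive_cos_sin_pow]. }
    unfold arc_sq. rewrite sum_n_S_real.
    replace (2 * S n + 4)%nat with (2 * n + 4 + 2)%nat by lia.
    replace (2 * S n + 2)%nat with (2 * n + 4)%nat by lia.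
    rewrite (arc_coef_S (S n)), (harmonic2_S (S n)).
    pose proof (pos_INR n).
    rewrite !S_INR, plus_INR, mult_INR. change (INR 2) with 2.
    replace (INR 4) with 4 by (simpl; ring).
    field. lra.
Qed.

(** * Convergence *)

Lemma abs_le_of_derive_bound (f df : R -> R) (x K : R) :
  0 <= x -> f 0 = 0 ->
  (forall t, 0 <= t <= x -> is_derive f t (df t)) ->
  (forall t, 0 <= t <= x -> Rabs (df t) <= K) ->
  Rabs (f x) <= K * x.
Proof.
  intros Hx H0 Hd HK.
  destruct (MVT_gen f 0 x df) as [c [Hc Heq]];
    rewrite ?Rmin_left, ?Rmax_right in * by lra.
  - intros t Ht. apply Hd. lra.
  - intros t Ht. apply continuity_pt_filterlim, (ex_derive_continuous f).
    exists (df t). apply Hd, Ht.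
  - rewrite H0, !Rminus_0_r in Heq. rewrite Heq, Rabs_mult, (Rabs_pos_eq x Hx).
    apply Rmult_le_compat_r; [exact Hx|]. apply HK, Hc.
Qed.

Lemma pow_sin_bounds (k : nat) (t x : R) :
  0 <= t <= x -> x < PI / 2 -> 0 <= sin t ^ k <= sin x ^ k.
Proof.
  intros Ht Hx. pose proof PI_RGT_0.
  assert (0 <= sin t) by (apply sin_ge_0; lra).
  split; [now apply pow_le|].
  apply pow_incr. split; [assumption|].
  apply sin_incr_1; lra.
Qed.

(** Dominates both boundary terms, with [u_n <= 1] and [H_n <= n]. *)
Definition boundary (n : nat) (x : R) : R :=
  2 * (INR n + 2) ^ 2 * (sin x ^ 2) ^ n.

Lemma boundary_arc (n : nat) (t x : R) :
  0 <= t <= x -> x < PI / 2 ->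
  0 <= (2 * INR n + 2) * arc_coef n * sin t ^ (2 * n + 2) <= boundary n x.
Proof.
  intros Ht Hx. unfold boundary. rewrite pow_add, <- pow_mult.
  pose proof (pow_sin_bounds (2 * n) t x Ht Hx).
  assert (0 <= sin t ^ 2 <= 1).
  { pose proof (SIN_bound t). nra. }
  pose proof (arc_coef_bounds n). pose proof (pos_INR n).
  assert (0 <= (2 * INR n + 2) * arc_coef n <= 2 * (INR n + 2) ^ 2) by nra.
  assert (0 <= sin t ^ (2 * n) * sin t ^ 2 <= sin x ^ (2 * n)) by nra.
  split.
  - apply Rmult_le_pos; lra.
  - apply Rmult_le_compat; lra.
Qed.

Lemma boundary_arc_cube (n : nat) (t x : R) :
  0 <= t <= x -> x < PI / 2 ->
  0 <= (2 * INR n + 4) * arc_coef (S n) * harmonic2 (S n)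
       * sin t ^ (2 * n + 4) <= boundary n x.
Proof.
  intros Ht Hx. unfold boundary. rewrite pow_add, <- pow_mult.
  pose proof (pow_sin_bounds (2 * n) t x Ht Hx).
  assert (0 <= sin t ^ 4 <= 1).
  { split; [apply pow_le, sin_ge_0; pose proof PI_RGT_0; lra|].
    rewrite <- (pow1 4). apply pow_incr. split.
    - apply sin_ge_0; pose proof PI_RGT_0; lra.
    - apply SIN_bound. }
  pose proof (arc_coef_bounds (S n)). pose proof (harmonic2_bounds (S n)) as HH.
  rewrite S_INR in HH. pose proof (pos_INR n).
  assert (0 <= arc_coef (S n) * harmonic2 (S n) <= INR n + 2) by nra.
  assert (0 <= (2 * INR n + 4) * arc_coef (S n) * harmonic2 (S n)
          <= 2 * (INR n + 2) ^ 2).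
  { rewrite Rmult_assoc. nra. }
  assert (0 <= sin t ^ (2 * n) * sin t ^ 4 <= sin x ^ (2 * n)) by nra.
  split.
  - apply Rmult_le_pos; lra.
  - apply Rmult_le_compat; lra.
Qed.

Lemma arc_error (n : nat) (t x : R) :
  0 <= t <= x -> x < PI / 2 -> Rabs (t - arc n t) <= boundary n x * t.
Proof.
  intros Ht Hx.
  apply (abs_le_of_derive_bound (fun t => t - arc n t)
    (fun t => (2 * INR n + 2) * arc_coef n * sin t ^ (2 * n + 2))); [lra| | |].
  - unfold arc. rewrite sum_n_eq_0; [ring|].
    intros i. rewrite sin_0, pow_i by lia. ring.
  - intros s _. evar_last.
    + apply is_derive_sub; [apply @is_derive_id|apply is_derive_arc].
    + change (@one R_AbsRing) with 1. ring.
  - intros s Hs. pose proof (boundary_arc n s x).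
    rewrite Rabs_pos_eq; lra.
Qed.

Lemma arc_sq_error (n : nat) (t x : R) :
  0 <= t <= x -> x < PI / 2 ->
  Rabs (t ^ 2 - arc_sq n t) <= 2 * boundary n x * x * t.
Proof.
  intros Ht Hx.
  apply (abs_le_of_derive_bound (fun t => t ^ 2 - arc_sq n t)
    (fun t => 2 * (t - arc n t))); [lra| | |].
  - unfold arc_sq. rewrite sum_n_eq_0; [ring|].
    intros i. rewrite sin_0, pow_i by lia. ring.
  - intros s _. evar_last.
    + apply is_derive_sub; [|apply is_derive_arc_sq].
      apply (is_derive_pow (fun t => t) 2 s 1), @is_derive_id.
    + simpl. ring.
  - intros s Hs. pose proof (arc_error n s x).
    pose proof (boundary_arc n s x).
    rewrite Rabs_mult, (Rabs_pos_eq 2) by lra. nra.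
Qed.

Lemma arc_cube_error (n : nat) (x : R) :
  0 <= x < PI / 2 ->
  Rabs (2 / 3 * x ^ 3 - arc_cube n x) <= boundary n x * (4 * x ^ 2 + 1) * x.
Proof.
  intros Hx.
  apply (abs_le_of_derive_bound (fun t => 2 / 3 * t ^ 3 - arc_cube n t)
    (fun t => 2 * (t ^ 2 - arc_sq n t)
      + (2 * INR n + 4) * arc_coef (S n) * harmonic2 (S n)
        * sin t ^ (2 * n + 4))); [lra| | |].
  - unfold arc_cube. rewrite sum_n_eq_0; [ring|].
    intros i. rewrite sin_0, pow_i by lia. ring.
  - intros s _. evar_last.
    + apply is_derive_sub; [|apply is_derive_arc_cube].
      apply is_derive_scal.
      apply (is_derive_pow (fun t => t) 3 s 1), @is_derive_id.
    + replace (INR 3) with 3 by (simpl; ring). simpl pred. field.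
  - intros s Hs.
    pose proof (arc_sq_error n s x Hs (proj2 Hx)).
    pose proof (boundary_arc n s x Hs (proj2 Hx)).
    pose proof (boundary_arc_cube n s x Hs (proj2 Hx)).
    eapply Rle_trans; [apply Rabs_triang|].
    rewrite Rabs_mult, (Rabs_pos_eq 2) by lra.
    rewrite (Rabs_pos_eq (_ * sin s ^ _)) by lra.
    assert (boundary n x * x * s <= boundary n x * x * x).
    { apply Rmult_le_compat_l; [apply Rmult_le_pos|]; lra. }
    simpl pow in *. lra.
Qed.

(** Ratio test: consecutive terms have ratio [(1 + 1 / (n + 2)) ^ 2 * r]. *)
Lemma is_lim_seq_sq_geom (r : R) :
  0 < r < 1 -> is_lim_seq (fun n => (INR n + 2) ^ 2 * r ^ n) 0.
Proof.
  intros Hr.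
  apply is_lim_seq_abs_0, ex_series_lim_0, (ex_series_DAlembert _ r); [lra| |].
  - intros n. pose proof (pos_INR n). pose proof (pow_lt r n (proj1 Hr)).
    apply Rgt_not_eq, Rmult_lt_0_compat; nra.
  - apply is_lim_seq_ext with (fun n => (1 + / (INR n + 2)) ^ 2 * r).
    + intros n. pose proof (pos_INR n). pose proof (pow_lt r n (proj1 Hr)).
      rewrite S_INR. simpl pow. rewrite Rabs_pos_eq.
      * field. lra.
      * apply Rdiv_le_0_compat; repeat apply Rmult_lt_0_compat
          || apply Rmult_le_pos; nra.
    + evar_last.
      * apply (is_lim_seq_scal_r _ r (Finite ((1 + 0) ^ 2))).
        apply (is_lim_seq_continuous (fun y => y ^ 2)); [reg|].
        apply is_lim_seq_plus'; [apply is_lim_seq_const|].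
        apply (is_lim_seq_inv _ p_infty); [|easy].
        eapply is_lim_seq_plus; [apply is_lim_seq_INR|apply is_lim_seq_const|].
        reflexivity.
      * simpl. f_equal. ring.
Qed.

(** With [y = sin x], this is the power series of
    [2 / 3 * arcsin y ^ 3 / sqrt (1 - y ^ 2)]; the partial sums are
    [arc_cube n x / cos x], so [arc_cube_error] gives the limit. *)
Lemma is_series_arc_cube (x : R) :
  0 < x < PI / 2 ->
  is_series (fun i => arc_coef (S i) * harmonic2 (S i) * sin x ^ (2 * i + 3))
    (2 / 3 * x ^ 3 / cos x).
Proof.
  intros Hx.
  assert (Hc : 0 < cos x) by (apply cos_gt_0; lra).
  assert (Hs : 0 < sin x) by (apply sin_gt_0; lra).
  assert (Hr : 0 < sin x ^ 2 < 1).
  { pose proof (sin2_cos2 x) as H. unfold Rsqr in H. simpl. nra. }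
  assert (Hlim : is_lim_seq (fun n => arc_cube n x) (2 / 3 * x ^ 3)).
  { apply is_lim_seq_ext
      with (fun n => 2 / 3 * x ^ 3 - (2 / 3 * x ^ 3 - arc_cube n x)).
    { intros n. ring. }
    replace (Finite (2 / 3 * x ^ 3)) with (Finite (2 / 3 * x ^ 3 - 0))
      by (f_equal; ring).
    apply is_lim_seq_minus'; [apply is_lim_seq_const|].
    apply is_lim_seq_abs_0.
    apply is_lim_seq_le_le with (u := fun _ => 0)
      (w := fun n => (INR n + 2) ^ 2 * (sin x ^ 2) ^ n
                     * (2 * (4 * x ^ 2 + 1) * x)).
    - intros n. split; [apply Rabs_pos|].
      eapply Rle_trans; [apply arc_cube_error; lra|].
      unfold boundary. right. ring.
    - apply is_lim_seq_const.
    - replace (Finite 0) with (Rbar_mult 0 (2 * (4 * x ^ 2 + 1) * x))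
        by (simpl; f_equal; ring).
      apply is_lim_seq_scal_r, is_lim_seq_sq_geom, Hr. }
  change (is_lim_seq (sum_n (fun i =>
    arc_coef (S i) * harmonic2 (S i) * sin x ^ (2 * i + 3)))
    (2 / 3 * x ^ 3 / cos x)).
  apply is_lim_seq_ext with (fun n => arc_cube n x * / cos x).
  { intros n. unfold arc_cube. field. lra. }
  apply (is_lim_seq_scal_r _ (/ cos x) (2 / 3 * x ^ 3)), Hlim.
Qed.

Theorem mainTheorem2 :
  is_series (fun n : nat => term (S n)) (8 * PI ^ 3 / (81 * sqrt 3)).
Proof.
  assert (Hq : sqrt 3 * sqrt 3 = 3) by (apply sqrt_sqrt; lra).
  assert (Hq0 : 0 < sqrt 3) by (apply sqrt_lt_R0; lra).
  pose proof PI_RGT_0.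
  pose proof (is_series_arc_cube (PI / 3) ltac:(lra)) as Hser.
  (* [sin (PI / 3) ^ (2 i + 1) = sqrt 3 / 2 * (3 / 4) ^ i], and [(3 / 4) ^ i]
     turns [4 ^ i] into [3 ^ i]; the factor [sqrt 3 / 2] is divided out. *)
  apply (is_series_scal (2 / sqrt 3)) in Hser.
  replace (8 * PI ^ 3 / (81 * sqrt 3))
    with (scal (2 / sqrt 3) (2 / 3 * (PI / 3) ^ 3 / cos (PI / 3))).
  2: { rewrite cos_PI3. unfold scal; simpl; unfold mult; simpl. field. lra. }
  eapply is_series_ext; [|exact Hser].
  intros n. rewrite sin_PI3. unfold term, arc_coef, harmonic2.
  replace (2 * n + 3)%nat with (S (2 * S n)) by lia.
  rewrite <- (tech_pow_Rmult (sqrt 3 / 2)), pow_mult.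
  replace ((sqrt 3 / 2) ^ 2) with (3 / 4) by (simpl; nra).
  replace (3 ^ S n) with (4 ^ S n * (3 / 4) ^ S n)
    by (rewrite <- Rpow_mult_distr; f_equal; field).
  pose proof (central_binomial_pos (S n)). pose proof (pos_INR (S n)).
  unfold scal; simpl scal; unfold mult; simpl mult.
  cbn -[INR pow sum_n_m Binomial.C Nat.mul]. field. repeat split; lra.
Qed.
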